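(* Let $\alpha>0$ and let $d,r\ge1$ be integers. Let $M=\bigoplus_{i=1}^r M_i$ and $N=\bigoplus_{i=1}^r N_i$ be the upset-decomposable modules over $\mathbb{R}^d$ whose summands are the upset modules with supports \[ \mathrm{supp}(M_i)=\{x\in\mathbb{R}^d\mid x\ge(2i\alpha,\dots,2i\alpha)\},\qquad \mathrm{supp}(N_i)=\{x\in\mathbb{R}^d\mid x\ge((2r+1)\alpha,\dots,(2r+1)\alpha)\}. \] Then \[ d_P(M,N)=\alpha\qquad\text{and}\qquad d_B(M,N)=d_I(M,N)=(2r-1)\alpha . \]
   Context: Fix a field $k$. $\mathbb{R}^d$ carries the product order; for $\varepsilon\in\mathbb{R}$ and $p\in\mathbb{R}^d$ write $p+\varepsilon:=p+(\varepsilon,\dots,\varepsilon)$. A (persistence) module is a functor $M$ from the poset $\mathbb{R}^d$ to $k$-vector spaces, with spaces $M_p$ and maps $M_{p\to q}$ for $p\le q$; morphisms are natural transformations; direct sums, submodules, images, preimages and quotients are pointwise. $M$ is pointwise finite-dimensional (pfd) if every $M_p$ is finite-dimensional. The shift $M(\varepsilon)$ is $M(\varepsilon)_p=M_{p+\varepsilon}$, $M(\varepsilon)_{p\to q}=M_{p+\varepsilon\to q+\varepsilon}$ (and $f(\varepsilon)$ denotes the shifted morphism); for $\varepsilon\le\delta$, $M_{\varepsilon\to\delta}:M(\varepsilon)\to M(\delta)$ is given at $p$ by $M_{p+\varepsilon\to p+\delta}$. Upset modules: an upset is $U\subseteq\mathbb{R}^d$ such that $p\in U$, $q\ge p$ imply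 $q\in U$. The associated upset module has $M_p=k$ for $p\in U$, $M_p=0$ otherwise, with $M_{p\to q}=\mathrm{Id}_k$ for $p\in U$, $p\le q$; its support is $U$. A module is upset-decomposable if it is isomorphic to a direct sum of upset modules. Barcode: a pfd module $M$ is isomorphic to a direct sum $\bigoplus_{i\in I}M_i$ of nonzero indecomposables, unique up to isomorphism and reindexing; the barcode $B(M)$ is the multiset $\{M_i\}_{i\in I}$ of isomorphism classes. Interleaving distance: $M\sim_\varepsilon N$ ($\varepsilon$-interleaved) means there are morphisms $\varphi:M\to N(\varepsilon)$, $\psi:N\to M(\varepsilon)$ with $\psi(\varepsilon)\circ\varphi=M_{0\to2\varepsilon}$ and $\varphi(\varepsilon)\circ\psi=N_{0\to2\varepsilon}$; $d_I(M,N)=\inf\{\varepsilon\ge0\mid M\sim_\varepsilon N\}$. Bottleneck distance: an $\varepsilon$-matching between pfd modules $M,N$ is a bijection $\sigma:\bar B(M)\to\bar B(N)$ between sub-multisets $\bar B(M)\subseteq B(M)$, $\bar B(N)\subseteq B(N)$ such that $Q\sim_\varepsilon\sigma(Q)$ for all $Q\in\bar B(M)$ and $Q\sim_\varepsilon 0$ for all unmatched $Q$ in $B(M)$ or $B(N)$. $d_B(M,N)=\inf\{\varepsilon\ge0\mid\text{there is an }\varepsilon\text{-matching between }M\text{ and }N\}\in[0,\infty]$. Pruning: for $\varepsilon\ge 0$ let $I$ be the largest submodule of $M$ such that $f(I)\subseteq M_{0\to2\varepsilon}(I)$ for every morphism $f:M\to M(2\varepsilon)$, and let $K$ be the smallest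 submodule of $I$ such that $(I_{0\to2\varepsilon})^{-1}(f(K))\subseteq K$ for every morphism $f:M\to M(2\varepsilon)$ (both exist). The $\varepsilon$-pruning of $M$ is $\mathrm{Pru}_\varepsilon(M):=(I/K)(-\varepsilon)$. Refinement: a subquotient of $M$ is a module isomorphic to $I'/K'$ for submodules $K'\subseteq I'\subseteq M$. An $\infty$-refinement of $M\cong\bigoplus_{i\in I}M_i$ (each $M_i$ indecomposable) is a module isomorphic to some $\bigoplus_{i\in I}N_i$ with each $N_i$ a (possibly zero) subquotient of $M_i$. Pruning distance: for pfd $M,N$, $d_P(M,N)$ is the infimum in $[0,\infty]$ of all $\varepsilon\ge0$ such that for every $\delta\ge0$, $\mathrm{Pru}_{\varepsilon+\delta}(M)$ is an $\infty$-refinement of $\mathrm{Pru}_\delta(N)$ and $\mathrm{Pru}_{\varepsilon+\delta}(N)$ is an $\infty$-refinement of $\mathrm{Pru}_\delta(M)$. *)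

(* Defs.v *)
From HB Require Import structures.
From mathcomp Require Import all_boot all_order all_algebra.
From mathcomp Require Import all_classical reals ereal.

Set Implicit Arguments.
Unset Strict Implicit.
Unset Printing Implicit Defensive.

Import Order.TTheory GRing.Theory Num.Theory.
Import Quotient.

Local Open Scope classical_set_scope.
Local Open Scope ring_scope.
Local Open Scope quotient_scope.

Section Linear.
Variable k : fieldType.

Section SubmodOf.
Variables (V : lmodType k) (S : set V).
Hypotheses (S0 : S 0) (SD : forall x y, S x -> S y -> S (x + y))
  (SZ : forall a x, S x -> S (a *: x)).

Fact submod_of_S_closed : GRing.subsemimod_closed (fun x => `[< S x >]).
Proof.
split; first split.
- exact/asboolP.
- by move=> x y /asboolP Sx /asboolP Sy; apply/asboolP/SD.
- by move=> a x /asboolP Sx; apply/asboolP/SZ.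
Qed.

Definition submod_of : submodClosed V :=
  HB.pack_for (submodClosed V) (fun x => `[< S x >])
    (GRing.isSubmodClosed.Build k V (fun x => `[< S x >]) submod_of_S_closed).

Lemma submod_ofP x : reflect (S x) (x \in submod_of).
Proof. exact: asboolP. Qed.

End SubmodOf.

Section SubspaceType.
Variables (V : lmodType k) (S : submodClosed V).

Record sub_space := SubSpace { sub_val : V; sub_valP : sub_val \in S }.

HB.instance Definition _ := [isSub for sub_val].
HB.instance Definition _ := [Choice of sub_space by <:].
HB.instance Definition _ := [SubChoice_isSubLmodule of sub_space by <:].

End SubspaceType.

Section SubSpaceMap.
Variables (V W : lmodType k) (S : submodClosed V) (T : submodClosed W).
Variables (f : {linear V -> W}) (fST : forall x, x \in S -> f x \in T).

Definition sub_map (x : sub_space S) : sub_space T :=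
  SubSpace (fST (sub_valP x)).

Fact sub_map_linear : linear sub_map.
Proof. by move=> a x y; apply/val_inj; rewrite /= linearP. Qed.

HB.instance Definition _ :=
  GRing.isLinear.Build k (sub_space S) (sub_space T) _ sub_map sub_map_linear.

End SubSpaceMap.

Section QuotSpace.
Variables (V : lmodType k) (S : submodClosed V).

Fact quot_S_zmod_closed : GRing.zmod_closed (fun x => x \in S).
Proof. exact: GRing.subsemimod_closedB (GRing.subsemimodClosedP S). Qed.

Definition submod_zmod : zmodClosed V :=
  HB.pack_for (zmodClosed V) (fun x => x \in S)
    (GRing.isZmodClosed.Build V (fun x => x \in S) quot_S_zmod_closed).

Definition quot_space := {quot submod_zmod}.

HB.instance Definition _ := GRing.Zmodule.on quot_space.

Definition quot_pi (x : V) : quot_space := \pi x.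

Lemma quot_piP x y : quot_pi x = quot_pi y <-> x - y \in S.
Proof.
rewrite -[x - y \in S]/(x - y \in submod_zmod) idealrBE.
by split=> [/eqP|/eqP].
Qed.

Lemma quot_pi_repr (q : quot_space) : quot_pi (repr q) = q.
Proof. exact: reprK. Qed.

Lemma quot_piD x y : quot_pi (x + y) = quot_pi x + quot_pi y.
Proof. by rewrite /quot_pi raddfD. Qed.

Definition quot_scale (a : k) (q : quot_space) : quot_space :=
  quot_pi (a *: repr q).

Fact quot_scaleE a x : quot_scale a (quot_pi x) = quot_pi (a *: x).
Proof.
by apply/quot_piP; rewrite -scalerBr rpredZ//; apply/quot_piP/quot_pi_repr.
Qed.

Fact quot_scaleA a b q : quot_scale a (quot_scale b q) = quot_scale (a * b) q.
Proof. by rewrite -[q]quot_pi_repr !quot_scaleE scalerA. Qed.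

Fact quot_scale1 : left_id 1 quot_scale.
Proof. by move=> q; rewrite -[q]quot_pi_repr quot_scaleE scale1r. Qed.

Fact quot_scaleDr : right_distributive quot_scale +%R.
Proof.
move=> a q r; rewrite -[q]quot_pi_repr -[r]quot_pi_repr -quot_piD !quot_scaleE.
by rewrite scalerDr quot_piD.
Qed.

Fact quot_scaleDl q : {morph quot_scale^~ q : a b / a + b}.
Proof.
by move=> a b; rewrite -[q]quot_pi_repr !quot_scaleE scalerDl quot_piD.
Qed.

HB.instance Definition _ := GRing.Zmodule_isLmodule.Build k quot_space
  quot_scaleA quot_scale1 quot_scaleDr quot_scaleDl.

Fact quot_pi_linear : linear quot_pi.
Proof. by move=> a x y; rewrite quot_piD -quot_scaleE. Qed.

HB.instance Definition _ :=
  GRing.isLinear.Build k V quot_space _ quot_pi quot_pi_linear.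

End QuotSpace.

Section QuotSpaceMap.
Variables (V W : lmodType k) (S : submodClosed V) (T : submodClosed W).
Variable f : {linear V -> W}.

(* The unused hypothesis makes the linear structure below inferable. *)
Definition quot_map of (forall x, x \in S -> f x \in T) :
    quot_space S -> quot_space T :=
  fun q => quot_pi T (f (repr q)).

Hypothesis fST : forall x, x \in S -> f x \in T.

Lemma quot_mapE x : quot_map fST (quot_pi S x) = quot_pi T (f x).
Proof.
by apply/quot_piP; rewrite -linearB fST//; apply/quot_piP; rewrite quot_pi_repr.
Qed.

Fact quot_map_linear : linear (quot_map fST).
Proof.
move=> a q r; rewrite -[q]quot_pi_repr -[r]quot_pi_repr -linearP !quot_mapE.
by rewrite !linearP.
Qed.

HB.instance Definition _ := GRing.isLinear.Build k (quot_space S) (quot_space T)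
  _ (quot_map fST) quot_map_linear.

End QuotSpaceMap.

Section DirectSum.
Variables (I : Type) (V : I -> lmodType k).

Record dsum_space := DsumSpace {
  ds_val :> forall i, V i;
  ds_fin : finite_set [set i | ds_val i <> 0] }.

HB.instance Definition _ := gen_eqMixin dsum_space.
HB.instance Definition _ := gen_choiceMixin dsum_space.

Lemma dsumP (x y : dsum_space) : (forall i, x i = y i) -> x = y.
Proof.
case: x y => [x xf] [y yf] /= xy.
have {}xy : x = y by apply: functional_extensionality_dep.
by subst y; rewrite (Prop_irrelevance xf yf).
Qed.

Fact dsum_fin0 : finite_set [set i | (fun j => 0 : V j) i <> 0].
Proof. by rewrite [X in finite_set X](_ : _ = set0)// -subset0 => i /=. Qed.

Fact dsum_finD (x y : dsum_space) : finite_set [set i | x i + y i <> 0].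
Proof.
apply: (@sub_finite_set _ _ ([set i | x i <> 0] `|` [set i | y i <> 0])).
  move=> i /= xy0; apply: contrapT => /not_orP[/contrapT x0 /contrapT y0].
  by apply: xy0; rewrite x0 y0 addr0.
by rewrite finite_setU; split; apply: ds_fin.
Qed.

Fact dsum_finZ a (x : dsum_space) : finite_set [set i | a *: x i <> 0].
Proof.
apply: sub_finite_set (ds_fin x) => i /= ax0 x0.
by apply: ax0; rewrite x0 scaler0.
Qed.

Fact dsum_finN (x : dsum_space) : finite_set [set i | - x i <> 0].
Proof.
by apply: sub_finite_set (ds_fin x) => i /= ax0 x0; apply: ax0; rewrite x0 oppr0.
Qed.

Fact dsum_addA : associative (fun x y => DsumSpace (dsum_finD x y)).
Proof. by move=> x y z; apply: dsumP => i /=; rewrite addrA. Qed.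
Fact dsum_addC : commutative (fun x y => DsumSpace (dsum_finD x y)).
Proof. by move=> x y; apply: dsumP => i /=; rewrite addrC. Qed.
Fact dsum_add0 : left_id (DsumSpace dsum_fin0) (fun x y => DsumSpace (dsum_finD x y)).
Proof. by move=> x; apply: dsumP => i /=; rewrite add0r. Qed.
Fact dsum_addN : left_inverse (DsumSpace dsum_fin0) (fun x => DsumSpace (dsum_finN x))
  (fun x y => DsumSpace (dsum_finD x y)).
Proof. by move=> x; apply: dsumP => i /=; rewrite addNr. Qed.

HB.instance Definition _ := GRing.isZmodule.Build dsum_space dsum_addA dsum_addC dsum_add0 dsum_addN.

Fact dsum_scaleA a b (x : dsum_space) :
  DsumSpace (dsum_finZ a (DsumSpace (dsum_finZ b x))) = DsumSpace (dsum_finZ (a * b) x).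
Proof. by apply: dsumP => i /=; rewrite scalerA. Qed.
Fact dsum_scale1 : left_id 1 (fun a x => DsumSpace (dsum_finZ a x)).
Proof. by move=> x; apply: dsumP => i /=; rewrite scale1r. Qed.
Fact dsum_scaleDr : right_distributive (fun a x => DsumSpace (dsum_finZ a x)) +%R.
Proof. by move=> a x y; apply: dsumP => i /=; rewrite scalerDr. Qed.
Fact dsum_scaleDl x : {morph (fun a => DsumSpace (dsum_finZ a x)) : a b / a + b}.
Proof. by move=> a b; apply: dsumP => i /=; rewrite scalerDl. Qed.

HB.instance Definition _ := GRing.Zmodule_isLmodule.Build k dsum_space
  dsum_scaleA dsum_scale1 dsum_scaleDr dsum_scaleDl.

Lemma dsum0E i : (0 : dsum_space) i = 0. Proof. by []. Qed.
Lemma dsumDE (x y : dsum_space) i : (x + y) i = x i + y i. Proof. by []. Qed.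
Lemma dsumZE a (x : dsum_space) i : (a *: x) i = a *: x i. Proof. by []. Qed.

End DirectSum.

Section DirectSumMap.
Variables (I : Type) (V W : I -> lmodType k) (f : forall i, {linear V i -> W i}).

Fact dsum_map_fin (x : dsum_space V) : finite_set [set i | f i (x i) <> 0].
Proof.
apply: sub_finite_set (ds_fin x) => i /= fx0 x0.
by apply: fx0; rewrite x0 linear0.
Qed.

Definition dsum_map (x : dsum_space V) : dsum_space W := DsumSpace (dsum_map_fin x).

Fact dsum_map_linear : linear dsum_map.
Proof. by move=> a x y; apply: dsumP => i; rewrite /= linearP. Qed.

HB.instance Definition _ := GRing.isLinear.Build k (dsum_space V) (dsum_space W)
  _ dsum_map dsum_map_linear.

End DirectSumMap.

End Linear.

Section Points.
Variables (R : realType) (d : nat).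
Implicit Types (p q r : 'rV[R]_d) (e : R).

Definition lev p q : bool := [forall i, p 0 i <= q 0 i].

Lemma levP p q : reflect (forall i, p 0 i <= q 0 i) (lev p q).
Proof. exact: forallP. Qed.

Lemma lev_refl p : lev p p. Proof. exact/levP. Qed.

Lemma lev_trans p q r : lev p q -> lev q r -> lev p r.
Proof. by move=> /levP pq /levP qr; apply/levP => i; apply: le_trans (qr i). Qed.

Definition translate p e : 'rV[R]_d := p + const_mx e.

Lemma lev_translate p q e : lev p q -> lev (translate p e) (translate q e).
Proof. by move=> /levP pq; apply/levP => i; rewrite !mxE lerD2r. Qed.

Lemma lev_translater p e : 0 <= e -> lev p (translate p e).
Proof. by move=> e0; apply/levP => i; rewrite !mxE lerDl. Qed.

Lemma lev_translate2 p e : 0 <= e -> lev p (translate (translate p e) e).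
Proof. by move=> e0; apply: lev_trans (lev_translater _ e0); apply: lev_translater. Qed.

End Points.

Section Modules.
Variables (k : fieldType) (R : realType) (d : nat).
Local Notation point := 'rV[R]_d.

Record pmodule := PModule {
  pm_space :> point -> lmodType k;
  pm_map : forall p q, lev p q -> {linear pm_space p -> pm_space q};
  pm_map_id : forall p (h : lev p p) x, pm_map h x = x;
  pm_map_comp : forall p q r (pq : lev p q) (qr : lev q r) (pr : lev p r) x,
    pm_map pr x = pm_map qr (pm_map pq x) }.
Arguments pm_map M {p q} h : rename.
Arguments pm_map_id M {p} h x : rename.
Arguments pm_map_comp M {p q r} pq qr pr x : rename.

Record pmor (M N : pmodule) := PMor {
  pmor_fun :> forall p, {linear M p -> N p};
  pmor_nat : forall p q (h : lev p q) (x : M p),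
    pmor_fun q (pm_map M h x) = pm_map N h (pmor_fun p x) }.

Definition pm_iso (M N : pmodule) : Prop :=
  exists (f : pmor M N) (g : pmor N M),
    (forall p x, g p (f p x) = x) /\ (forall p y, f p (g p y) = y).

Definition pm_is_zero (M : pmodule) : Prop := forall p (x : M p), x = 0.

Definition pm_zero : pmodule.
Proof.
refine (@PModule (fun=> 'rV[k]_0) (fun p q _ => idfun) _ _).
- by [].
- by [].
Defined.

Definition shift (M : pmodule) (e : R) : pmodule.
Proof.
refine (@PModule (fun p => M (translate p e))
  (fun p q h => pm_map M (lev_translate e h)) _ _).
- by move=> p h x; apply: pm_map_id.
- by move=> p q r pq qr pr x; apply: pm_map_comp.
Defined.

Definition transition (M : pmodule) (e : R) (e0 : 0 <= e) : pmor M (shift M e).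
Proof.
refine (@PMor M (shift M e) (fun p => pm_map M (lev_translater p e0)) _).
move=> p q h x /=.
have h' := lev_trans h (lev_translater q e0).
by rewrite -(pm_map_comp _ _ _ h') -(pm_map_comp _ _ _ h').
Defined.

Record submodule (M : pmodule) := Submodule {
  sm_space :> forall p, submodClosed (M p);
  sm_map : forall p q (h : lev p q) (x : M p),
    x \in sm_space p -> pm_map M h x \in sm_space q }.

Definition subm_le (M : pmodule) (S T : submodule M) : Prop :=
  forall p (x : M p), x \in S p -> x \in T p.

Definition sub_pm (M : pmodule) (S : submodule M) : pmodule.
Proof.
refine (@PModule (fun p => sub_space (S p))
  (fun p q h => sub_map (T := S q) (sm_map (s := S) h)) _ _).
- by move=> p h x; apply: val_inj; apply: pm_map_id.
- by move=> p q r pq qr pr x; apply: val_inj; apply: pm_map_comp.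
Defined.

Definition quot_pm (M : pmodule) (S : submodule M) : pmodule.
Proof.
refine (@PModule (fun p => quot_space (S p))
  (fun p q h => quot_map (T := S q) (sm_map (s := S) h)) _ _).
- move=> p h x; rewrite -[x]quot_pi_repr.
  by rewrite [LHS](quot_mapE (sm_map h)) pm_map_id.
- move=> p q r pq qr pr x; rewrite -[x]quot_pi_repr.
  rewrite [LHS](quot_mapE (sm_map pr)) (pm_map_comp _ pq qr); apply: esym.
  apply: etrans (quot_mapE (sm_map qr) _).
  exact: (congr1 (quot_map (sm_map qr)) (quot_mapE (sm_map pq) _)).
Defined.

Definition dsum_pm (I : Type) (F : I -> pmodule) : pmodule.
Proof.
refine (@PModule (fun p => dsum_space (fun i => F i p))
  (fun p q h => dsum_map (fun i => pm_map (F i) h)) _ _).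
- by move=> p h x; apply: dsumP => i; apply: pm_map_id.
- by move=> p q r pq qr pr x; apply: dsumP => i; apply: pm_map_comp.
Defined.

Definition indecomposable (M : pmodule) : Prop :=
  ~ pm_is_zero M /\
  forall F : bool -> pmodule, pm_iso M (dsum_pm F) ->
    pm_is_zero (F true) \/ pm_is_zero (F false).

(* The family [F] represents the multiset B(M); when M is pointwise finite-
   dimensional such a family exists and is unique up to reindexing and
   isomorphism of its members. *)
Definition barcode (M : pmodule) (I : Type) (F : I -> pmodule) : Prop :=
  (forall i, indecomposable (F i)) /\ pm_iso M (dsum_pm F).

Record upset := Upset {
  up_set : set point;
  up_closed : forall p q, up_set p -> lev p q -> up_set q }.

Definition upset_space (b : bool) : lmodType k :=
  if b return lmodType k then k^o else 'rV[k]_0.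

Definition upset_map (a b : bool) : {linear upset_space a -> upset_space b} :=
  match a, b return {linear upset_space a -> upset_space b} with
  | true, true => idfun
  | _, _ => \0
  end.

Definition upset_pm (U : upset) : pmodule.
Proof.
refine (@PModule (fun p => upset_space `[< up_set U p >])
  (fun p q _ => upset_map `[< up_set U p >] `[< up_set U q >]) _ _).
- by move=> p h; case: asboolP => //= _ x; rewrite [x]thinmx0.
- move=> p q r pq qr pr.
  have : `[< up_set U p >] ==> `[< up_set U q >].
    by apply/implyP => /asboolP Up; apply/asboolP/(up_closed Up).
  have : `[< up_set U q >] ==> `[< up_set U r >].
    by apply/implyP => /asboolP Uq; apply/asboolP/(up_closed Uq).
  by case: `[< up_set U p >]; case: `[< up_set U q >]; case: `[< up_set U r >].
Defined.

Definition orthant (c : R) : upset :=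
  @Upset [set x | lev (const_mx c) x] (fun p q cp pq => lev_trans cp pq).

(* [M(e)(e)] is identified with [M(2e)]: both composites at p take values in
   the space at (p + e) + e. *)
Definition interleaved (e : R) (e0 : 0 <= e) (M N : pmodule) : Prop :=
  exists (phi : pmor M (shift N e)) (psi : pmor N (shift M e)),
    (forall p (x : M p),
       psi (translate p e) (phi p x) = pm_map M (lev_translate2 p e0) x) /\
    (forall p (y : N p),
       phi (translate p e) (psi p y) = pm_map N (lev_translate2 p e0) y).

Definition dI (M N : pmodule) : \bar R :=
  ereal_inf [set e%:E | e in [set e : R | exists e0 : 0 <= e,
    interleaved e0 M N]].

Definition matching (e : R) (e0 : 0 <= e) (M N : pmodule) : Prop :=
  exists (I J : Type) (F : I -> pmodule) (G : J -> pmodule),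
    barcode M F /\ barcode N G /\
    exists (A : set I) (B : set J) (s : A -> B),
      bijective s /\
      (forall i : A, interleaved e0 (F (val i)) (G (val (s i)))) /\
      (forall i : I, ~ A i -> interleaved e0 (F i) pm_zero) /\
      (forall j : J, ~ B j -> interleaved e0 (G j) pm_zero).

Definition dB (M N : pmodule) : \bar R :=
  ereal_inf [set e%:E | e in [set e : R | exists e0 : 0 <= e,
    matching e0 M N]].

Section Pruning.
Variables (M : pmodule) (e : R) (e0 : 0 <= e).

Fact mul2_ge0 : 0 <= 2 * e. Proof. by rewrite mulr_ge0. Qed.

Definition pruI_cond (S : submodule M) : Prop :=
  forall (f : pmor M (shift M (2 * e))) p (x : M p), x \in S p ->
    exists2 y : M p, y \in S p & f p x = transition M mul2_ge0 p y.

(* The largest submodule satisfying [pruI_cond] is the sum of all of them, which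
   is their union because they form a directed family. *)
Definition pruI_set p : set (M p) :=
  [set x | exists S : submodule M, pruI_cond S /\ x \in S p].

Fact pruI_set0 p : pruI_set (0 : M p).
Proof.
pose Z q (x : M q) := x = 0.
have Z0 q : Z q 0 by [].
have ZD q (x y : M q) : Z q x -> Z q y -> Z q (x + y).
  by rewrite /Z => -> ->; rewrite addr0.
have ZZ q a (x : M q) : Z q x -> Z q (a *: x).
  by rewrite /Z => ->; rewrite scaler0.
have Zmap q r (h : lev q r) (x : M q) : x \in submod_of (Z0 q) (@ZD q) (@ZZ q) ->
    pm_map M h x \in submod_of (Z0 r) (@ZD r) (@ZZ r).
  by move=> /submod_ofP; rewrite /Z => ->; apply/submod_ofP; rewrite /Z linear0.
exists (Submodule Zmap); split; last by apply/submod_ofP.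
move=> f q x /submod_ofP; rewrite /Z => ->; exists 0; first by apply/submod_ofP.
by rewrite !linear0.
Qed.

Fact pruI_setD p (x y : M p) : pruI_set x -> pruI_set y -> pruI_set (x + y).
Proof.
move=> [S [Sc Sx]] [T [Tc Ty]].
pose U q : set (M q) := [set z | exists s t, [/\ s \in S q, t \in T q & z = s + t]].
have U0 q : U q 0 by exists 0, 0; split; rewrite ?rpred0 ?addr0.
have UD q (z w : M q) : U q z -> U q w -> U q (z + w).
  move=> [s [t [sS tT ->]]] [s' [t' [sS' tT' ->]]].
  by exists (s + s'), (t + t'); split; rewrite ?rpredD// addrACA.
have UZ q a (z : M q) : U q z -> U q (a *: z).
  move=> [s [t [sS tT ->]]].
  by exists (a *: s), (a *: t); split; rewrite ?rpredZ// scalerDr.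
have Umap q r (h : lev q r) (z : M q) : z \in submod_of (U0 q) (@UD q) (@UZ q) ->
    pm_map M h z \in submod_of (U0 r) (@UD r) (@UZ r).
  move=> /submod_ofP[s [t [sS tT ->]]]; apply/submod_ofP.
  by exists (pm_map M h s), (pm_map M h t); split; rewrite ?sm_map// linearD.
exists (Submodule Umap); split; last first.
  by apply/(submod_ofP (U0 p) (@UD p) (@UZ p)); exists x, y.
move=> f q z /submod_ofP /= [s [t [sS tT ->]]].
have [s' sS' fs] := Sc f q s sS; have [t' tT' ft] := Tc f q t tT.
exists (s' + t'); first by apply/(submod_ofP (U0 q) (@UD q) (@UZ q)); exists s', t'.
by rewrite !linearD/= fs ft.
Qed.

Fact pruI_setZ p a (x : M p) : pruI_set x -> pruI_set (a *: x).
Proof. by move=> [S [Sc Sx]]; exists S; rewrite rpredZ. Qed.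

Definition pruI_space p : submodClosed (M p) :=
  submod_of (@pruI_set0 p) (@pruI_setD p) (@pruI_setZ p).

Fact pruI_map p q (h : lev p q) (x : M p) :
  x \in pruI_space p -> pm_map M h x \in pruI_space q.
Proof.
move=> /submod_ofP[S [Sc Sx]]; apply/submod_ofP.
by exists S; rewrite sm_map.
Qed.

Definition pruI : submodule M := Submodule pruI_map.

Lemma pruI_condP : pruI_cond pruI.
Proof.
move=> f p x /submod_ofP[S [Sc Sx]]; have [y Sy fxy] := Sc f p x Sx.
by exists y => //; apply/submod_ofP; exists S.
Qed.

Lemma pruI_largest (S : submodule M) : pruI_cond S -> subm_le S pruI.
Proof. by move=> Sc p x Sx; apply/submod_ofP; exists S. Qed.

Definition pruK_cond (S : submodule (sub_pm pruI)) : Prop :=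
  forall (f : pmor M (shift M (2 * e))) p (x y : sub_pm pruI p), y \in S p ->
    val (transition (sub_pm pruI) mul2_ge0 p x) = f p (val y) -> x \in S p.

(* The smallest submodule satisfying [pruK_cond] is the intersection of all of
   them. *)
Definition pruK_set p : set (sub_pm pruI p) :=
  [set x | forall S : submodule (sub_pm pruI), pruK_cond S -> x \in S p].

Fact pruK_set0 p : pruK_set (0 : sub_pm pruI p).
Proof. by move=> S _; rewrite rpred0. Qed.

Fact pruK_setD p (x y : sub_pm pruI p) :
  pruK_set x -> pruK_set y -> pruK_set (x + y).
Proof. by move=> Kx Ky S Sc; rewrite rpredD// ?Kx ?Ky. Qed.

Fact pruK_setZ p a (x : sub_pm pruI p) : pruK_set x -> pruK_set (a *: x).
Proof. by move=> Kx S Sc; rewrite rpredZ// Kx. Qed.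

Definition pruK_space p : submodClosed (sub_pm pruI p) :=
  submod_of (@pruK_set0 p) (@pruK_setD p) (@pruK_setZ p).

Fact pruK_map p q (h : lev p q) (x : sub_pm pruI p) :
  x \in pruK_space p -> pm_map (sub_pm pruI) h x \in pruK_space q.
Proof.
by move=> /submod_ofP Kx; apply/submod_ofP => S Sc; apply/sm_map/Kx.
Qed.

Definition pruK : submodule (sub_pm pruI) := Submodule pruK_map.

Lemma pruK_condP : pruK_cond pruK.
Proof.
move=> f p x y /submod_ofP Ky xy; apply/submod_ofP => S Sc.
exact: Sc (Ky S Sc) xy.
Qed.

Lemma pruK_smallest (S : submodule (sub_pm pruI)) :
  pruK_cond S -> subm_le pruK S.
Proof. by move=> Sc p x /submod_ofP; apply. Qed.

Definition pruning : pmodule := shift (quot_pm pruK) (- e).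

End Pruning.

Definition subquotient (Q M : pmodule) : Prop :=
  exists (S : submodule M) (T : submodule (sub_pm S)), pm_iso Q (quot_pm T).

Definition refinement (Q M : pmodule) : Prop :=
  exists (I : Type) (F G : I -> pmodule),
    barcode M F /\ (forall i, subquotient (G i) (F i)) /\ pm_iso Q (dsum_pm G).

Definition dP (M N : pmodule) : \bar R :=
  ereal_inf [set e%:E | e in [set e : R | exists e0 : 0 <= e,
    forall (t : R) (t0 : 0 <= t),
      refinement (pruning M (addr_ge0 e0 t0)) (pruning N t0) /\
      refinement (pruning N (addr_ge0 e0 t0)) (pruning M t0)]].

End Modules.

(* Main.v *)
From HB Require Import structures.
Require Import Defs.
From mathcomp Require Import all_boot all_order all_algebra.
From mathcomp Require Import lra.
From mathcomp Require Import all_classical reals ereal.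
Import Order.TTheory GRing.Theory Num.Theory.
Local Open Scope ring_scope.

Set Implicit Arguments.
Unset Strict Implicit.
Unset Printing Implicit Defensive.

(** A finite sum of orthant modules with corners [c i] has injective structure
maps, so it can be viewed inside its colimit, a vector space with one
coordinate per summand: the space at [p] consists of the vectors supported on
the [i] with corner below [p]. In these coordinates ([is_coord]) a morphism
into a shift by [e] is a constant matrix whose entry from [i] to [j] can be
nonzero only if [c j <= c i + e] ([coord_mor], [coord_hom_supp]).

Pruning by [e] then becomes combinatorial. The relation
[c j <= c i + 2 * e] says that some endomorphism into the [2 * e]-shift moves
the coordinate [i] to [j], hence the submodule [I] in the definition of
pruning keeps the coordinate [i] exactly from the point on where every [j]
reachable from [i] is present. The submodule [K] vanishes because the structure
maps are injective. So pruning raises each corner [c i] to the largest reachable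
corner plus [e] ([pruning_orthants]).

For the staircase [2 * alpha, 4 * alpha, ..., 2 * r * alpha] consecutive steps
become coupled precisely when [e >= alpha]. Pruning by [e >= alpha] moves all
corners of [M] to [2 * r * alpha + e], and the prunings of [M] by [alpha + t]
and of [N] by [t] coincide; this gives [dP <= alpha]. For [e < alpha] the lowest
corner of [M] stays isolated, its pruning is nonzero at [2 * alpha + e], where
[N] is still zero, and this contradicts refinement.

The interleaving and bottleneck distances only see the lowest corner
[2 * alpha] of [M]: an element there survives every structure map, so an
[e]-interleaving or an [e]-matching must make [N] nonzero at [2 * alpha + e]
([zero_at_interleaved], [zero_at_matching]). Conversely, matching the
summands index by index has cost at most [(2 * r - 1) * alpha]. *)

(** * Persistence modules *)

Section LinearOf.
Variables (k : fieldType) (V W : lmodType k) (f : V -> W) (fP : linear f).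

Definition linear_of : {linear V -> W} :=
  HB.pack f (GRing.isLinear.Build k V W _ f fP).

End LinearOf.

Section Basics.
Variables (k : fieldType) (R : realType) (d : nat).
Local Notation pmod := (pmodule k R d).
Implicit Types (M N A B : pmod) (p q : 'rV[R]_d).

Lemma pmor_of M N (f : forall p, M p -> N p) (f_lin : forall p, linear (f p)) :
  (forall p q (h : lev p q) x, f q (pm_map M h x) = pm_map N h (f p x)) ->
  exists g : pmor M N, forall p x, g p x = f p x.
Proof.
by move=> fN; exists (@PMor _ _ _ M N (fun p => linear_of (f_lin p)) fN).
Qed.

Lemma pm_iso_refl M : pm_iso M M.
Proof.
have [f fE] := @pmor_of M M (fun p x => x) (fun p a x y => erefl)
  (fun p q h x => erefl).
by exists f, f; split=> p x; rewrite !fE.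
Qed.

Lemma pm_iso_sym M N : pm_iso M N -> pm_iso N M.
Proof. by move=> [f [g [gf fg]]]; exists g, f. Qed.

Lemma pm_iso_trans A M N : pm_iso A M -> pm_iso M N -> pm_iso A N.
Proof.
move=> [f [g [gf fg]]] [f' [g' [gf' fg']]].
have [h hE] : exists h : pmor A N, forall p x, h p x = f' p (f p x).
  apply: pmor_of => [p a x y|p q h x]; first by rewrite !linearP.
  by rewrite !pmor_nat.
have [h' hE'] : exists h : pmor N A, forall p x, h p x = g p (g' p x).
  apply: pmor_of => [p a x y|p q h' x]; first by rewrite !linearP.
  by rewrite !pmor_nat.
exists h, h'; split=> p x; rewrite hE hE' ?gf' ?gf ?fg ?fg' //.
Qed.

Lemma pm_iso_bij M N (f : pmor M N) :
    (forall p x, f p x = 0 -> x = 0) -> (forall p y, exists x, f p x = y) ->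
  pm_iso M N.
Proof.
move=> f_inj f_surj.
have fI p : injective (f p).
  by move=> x y /eqP; rewrite -subr_eq0 -linearB => /eqP/f_inj/eqP; rewrite subr_eq0 => /eqP.
pose g p y := projT1 (cid (f_surj p y)).
have fg p y : f p (g p y) = y by rewrite /g; case: cid.
have [h hE] : exists h : pmor N M, forall p x, h p x = g p x.
  apply: pmor_of => [p a x y|p q h x]; apply: (fI); first by rewrite linearP !fg.
  by rewrite pmor_nat !fg.
by exists f, h; split=> p x; rewrite hE ?fg //; apply: (fI); rewrite fg.
Qed.

Lemma pm_iso_shift M N e : pm_iso M N -> pm_iso (shift M e) (shift N e).
Proof.
move=> [f [g [gf fg]]].
have [f' fE] : exists h : pmor (shift M e) (shift N e),
    forall p x, h p x = f (translate p e) x.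
  apply: pmor_of => [p a x y|p q h x]; first by rewrite linearP.
  by rewrite /= pmor_nat.
have [g' gE] : exists h : pmor (shift N e) (shift M e),
    forall p x, h p x = g (translate p e) x.
  apply: pmor_of => [p a x y|p q h x]; first by rewrite linearP.
  by rewrite /= pmor_nat.
by exists f', g'; split=> p x; rewrite fE gE ?gf ?fg.
Qed.

Lemma pm_iso_quot0 M (K : submodule M) :
  (forall p x, x \in K p -> x = 0) -> pm_iso M (quot_pm K).
Proof.
move=> K0.
have [f fE] : exists f : pmor M (quot_pm K), forall p x, f p x = quot_pi (K p) x.
  apply: pmor_of => [p a x y|p q h x]; first exact: linearP.
  by rewrite [RHS](quot_mapE (sm_map h)).
apply: (pm_iso_bij (f := f)) => [p x|p y].
  rewrite fE => fx0; apply: (K0 p).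
  rewrite -[x]subr0; apply/quot_piP; rewrite fx0; exact/esym/(linear0 (@quot_pi k _ (K p))).
by exists (repr y); rewrite fE quot_pi_repr.
Qed.

Lemma subm_of M (S : forall p, set (M p)) :
    (forall p, S p 0) ->
    (forall p a x y, S p x -> S p y -> S p (a *: x + y)) ->
    (forall p q (h : lev p q) x, S p x -> S q (pm_map M h x)) ->
  exists T : submodule M, forall p x, x \in T p <-> S p x.
Proof.
move=> S0 Slin Smap.
have SD p x y : S p x -> S p y -> S p (x + y).
  by move=> Sx Sy; rewrite -[x]scale1r; apply: Slin.
have SZ p a x : S p x -> S p (a *: x).
  by move=> Sx; rewrite -[_ *: _]addr0; apply: Slin.
have Tmap p q (h : lev p q) x : x \in submod_of (S0 p) (@SD p) (@SZ p) ->
    pm_map M h x \in submod_of (S0 q) (@SD q) (@SZ q).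
  by move=> /submod_ofP Sx; apply/submod_ofP; apply: Smap.
by exists (Submodule Tmap) => p x; split=> [/submod_ofP //|Sx]; apply/submod_ofP.
Qed.

(** A submodule is a subquotient: the image of [f] divided by its zero
submodule. *)
Lemma subquotient_inj M N (f : pmor M N) :
  (forall p x, f p x = 0 -> x = 0) -> subquotient M N.
Proof.
move=> f_inj.
have [S SE] : exists S : submodule N, forall p y, y \in S p <-> range (f p) y.
  apply: subm_of => [p|p a x y [u _ <-] [v _ <-]|p q h x [u _ <-]].
  - by exists 0; rewrite ?linear0.
  - by exists (a *: u + v); rewrite ?linearP.
  - by exists (pm_map M h u); rewrite ?pmor_nat.
have [T TE] : exists T : submodule (sub_pm S), forall p y, y \in T p <-> y = 0.
  by apply: subm_of => [p|p a x y -> ->|p q h x ->]; rewrite ?linear0 ?addr0.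
exists S, T; apply: (@pm_iso_trans _ (sub_pm S)); last first.
  by apply: pm_iso_quot0 => p x /TE.
have f_im p x : f p x \in S p by apply/SE; exists x.
have [g gE] : exists g : pmor M (sub_pm S), forall p x, g p x = SubSpace (f_im p x).
  apply: pmor_of => [p a x y|p q h x]; apply: val_inj; first exact: linearP.
  exact: pmor_nat.
apply: (pm_iso_bij (f := g)) => [p x|p [y yf]].
  by rewrite gE => /(congr1 val); apply: f_inj.
have /SE [x _ fx] := yf; exists x.
by rewrite gE; apply: val_inj.
Qed.

(** The index type carries no decidable equality, so equality of indices is
decided classically and the value is transported along it. *)
Definition ds_single (I : Type) (V : I -> lmodType k) (i : I) (x : V i) :
  forall j, V j := fun j => if pselect (i = j) is left e then ecast l (V l) e x else 0.

Lemma ds_single_fin I (V : I -> lmodType k) (i : I) (x : V i) :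
  finite_set [set j | ds_single x j <> 0].
Proof.
apply: sub_finite_set (finite_set1 i) => j /=.
by rewrite /ds_single; case: pselect => // e _; exact/esym.
Qed.

Lemma ds_singleE I (V : I -> lmodType k) (i : I) (x : V i) :
  ds_single x i = x.
Proof.
by rewrite /ds_single; case: pselect => // e; rewrite (Prop_irrelevance e erefl).
Qed.

Lemma ds_singleN I (V : I -> lmodType k) (i j : I) (x : V i) :
  i <> j -> ds_single x j = 0.
Proof. by rewrite /ds_single; case: pselect. Qed.

Lemma dsum_eq0P I (V : I -> lmodType k) :
  (forall x : dsum_space V, x = 0) <-> (forall i (x : V i), x = 0).
Proof.
split=> [V0 i x|V0 x]; last by apply: dsumP => i; apply: V0.
have := congr1 (fun y => ds_val y i) (V0 (DsumSpace (ds_single_fin x))).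
by rewrite /= ds_singleE.
Qed.

Definition zero_at M p := forall x : M p, x = 0.

Lemma zero_at_iso M N p : pm_iso M N -> zero_at N p -> zero_at M p.
Proof. by move=> [f [g [gf _]]] N0 x; rewrite -[x]gf [f p x]N0 linear0. Qed.

Lemma zero_at_subquotient M N p : subquotient M N -> zero_at N p -> zero_at M p.
Proof.
move=> [S [T MST]] N0; apply: zero_at_iso MST _ => x.
rewrite -[x]quot_pi_repr (_ : repr x = 0) ?(linear0 (@quot_pi k _ (T p))) //.
by apply: val_inj; rewrite /= [LHS]N0.
Qed.

(** Refinement can only shrink supports: this is how lower bounds for the
pruning distance are obtained. *)
Lemma zero_at_refinement M N p : refinement M N -> zero_at N p -> zero_at M p.
Proof.
move=> [I [F [G [[_ NF] [GF MG]]]]] N0; apply: zero_at_iso MG _.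
have /dsum_eq0P F0 : zero_at (dsum_pm F) p := zero_at_iso (pm_iso_sym NF) N0.
by apply/dsum_eq0P => i; apply: zero_at_subquotient (GF i) _; apply: F0.
Qed.

Definition pm_mono M := forall p q (h : lev p q) x, pm_map M h x = 0 -> x = 0.

Lemma pm_mono_iso M N : pm_iso M N -> pm_mono N -> pm_mono M.
Proof.
move=> [f [g [gf _]]] N_mono p q h x hx0.
by rewrite -[x]gf [f p x](N_mono _ _ h) ?linear0 // -pmor_nat hx0 linear0.
Qed.

Lemma pm_mono_dsum I (F : I -> pmod) : pm_mono (dsum_pm F) -> forall i, pm_mono (F i).
Proof.
move=> F_mono i p q h x hx0.
pose u : dsum_pm F p := DsumSpace (ds_single_fin (V := fun j => F j p) x).
have : pm_map (dsum_pm F) h u = 0.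
  apply: dsumP => j /=; have [<-|ij] := pselect (i = j).
    by rewrite (ds_singleE (V := fun j => F j p)).
  by rewrite ds_singleN ?linear0.
move/F_mono => /(congr1 (fun w => ds_val w i)).
by rewrite /= (ds_singleE (V := fun j => F j p)).
Qed.

(** The structure map of length [2 * e] of [M] is injective and factors
through [N] at [p + e]. *)
Lemma zero_at_interleaved M N e (e0 : 0 <= e) p : pm_mono M ->
  interleaved e0 M N -> zero_at N (translate p e) -> zero_at M p.
Proof.
move=> M_mono [phi [psi [psiphi _]]] N0 x.
by apply: (M_mono _ _ (lev_translate2 p e0)); rewrite -psiphi [phi p x]N0 linear0.
Qed.

(** Every summand of [M] inherits injective structure maps. If [N] vanishes
at [p + e], then so does the partner of each matched summand, and a summand
interleaved with zero at [p + e] is zero at [p]. *)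
Lemma zero_at_matching M N e (e0 : 0 <= e) p : pm_mono M ->
  matching e0 M N -> zero_at N (translate p e) -> zero_at M p.
Proof.
move=> M_mono [I [J [F [G [[_ MF] [[_ NG] [A [B [s [_ [FG [F0 _]]]]]]]]]]]] N0.
have F_mono := pm_mono_dsum (pm_mono_iso (pm_iso_sym MF) M_mono).
have /dsum_eq0P G0 := zero_at_iso (pm_iso_sym NG) N0.
apply: zero_at_iso MF _; apply/dsum_eq0P => i.
have [Ai|nAi] := pselect (A i); last first.
  by apply: zero_at_interleaved (F_mono i) (F0 i nAi) _ => x; apply: thinmx0.
have Fi := FG (SigSub (mem_set Ai)).
by apply: zero_at_interleaved (F_mono i) Fi _ => x; apply: G0.
Qed.

End Basics.

(** * Coordinates on sums of orthants *)

Section Coordinates.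
Variables (k : fieldType) (R : realType) (d : nat).
Local Notation pmod := (pmodule k R d).
Implicit Types (M N : pmod) (p q : 'rV[R]_d).

(** The functions [crd p i] identify [M] with the sum of the orthant modules
with corners [c i]. Being stated through linear forms, this passes to shifts
and submodules without casts between the spaces of [M]. *)
Record is_coord M (I : Type) (c : I -> R)
    (crd : forall p, I -> {linear M p -> k^o}) : Prop := IsCoord {
  coord_nat : forall p q (h : lev p q) x i, crd q i (pm_map M h x) = crd p i x;
  coord_inj : forall p x y, (forall i, crd p i x = crd p i y) -> x = y;
  coord_supp : forall p x i, crd p i x != 0 -> lev (const_mx (c i)) p;
  coord_surj : forall p (v : I -> k),
    (forall i, v i != 0 -> lev (const_mx (c i)) p) ->
    exists x, forall i, crd p i x = v i }.

Lemma lev_const a b : (0 < d)%N ->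
  lev (const_mx a : 'rV[R]_d) (const_mx b) -> a <= b.
Proof. by case: d => // n _ /levP/(_ ord0); rewrite !mxE. Qed.

Lemma lev_const_le a b p : a <= b -> lev (const_mx b) p -> lev (const_mx a) p.
Proof. by move=> ab; apply: lev_trans; apply/levP => i; rewrite !mxE. Qed.

Lemma lev_const_translate a p e :
  lev (const_mx a) (translate p e) = lev (const_mx (a - e)) p.
Proof. by apply: eq_forallb => i; rewrite !mxE lerBlDr. Qed.

Lemma coord_eq0 M I (c : I -> R) crd p (x : M p) : is_coord c crd ->
  (forall i, crd p i x = 0) -> x = 0.
Proof.
by move=> Mc x0; apply: (coord_inj Mc) => i; rewrite x0 linear0.
Qed.

Lemma coord_mono M I (c : I -> R) crd : @is_coord M I c crd -> pm_mono M.
Proof.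
move=> Mc p q h x hx0; apply: (coord_eq0 Mc) => i.
by rewrite -(coord_nat Mc h) hx0 linear0.
Qed.

Lemma coord_zero_atP M I (c : I -> R) crd p : @is_coord M I c crd ->
  zero_at M p <-> forall i, ~~ lev (const_mx (c i)) p.
Proof.
move=> Mc; split=> [M0 i|no_i x]; last first.
  by apply: (coord_eq0 Mc) => i; apply: contraNeq (no_i i) => /(coord_supp Mc).
apply/negP => ip.
have [|x xE] := coord_surj Mc (p := p) (v := fun j => if `[< j = i >] then 1 else 0).
  by move=> j; case: asboolP => [->//|_]; rewrite eqxx.
have := xE i; rewrite [x]M0 linear0 asboolT // => /esym/eqP.
by rewrite oner_eq0.
Qed.

(** A matrix defines a morphism as soon as its nonzero entries go from a
corner to a smaller or equal one, because then the image of a vector supported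
at [p] is again supported at [p]. *)
Lemma coord_mor M N (I : finType) J (c : I -> R) (c' : J -> R) crd crd'
    (A : J -> I -> k) :
    @is_coord M I c crd -> @is_coord N J c' crd' ->
    (forall j i, A j i != 0 -> c' j <= c i) ->
  exists f : pmor M N, forall p x j,
    crd' p j (f p x) = \sum_i A j i * crd p i x.
Proof.
move=> Mc Nc A_le.
have ex p (x : M p) : exists y, forall j, crd' p j y = \sum_i A j i * crd p i x.
  apply: (coord_surj Nc) => j sum_neq0.
  have [i] : exists i, A j i * crd p i x != 0.
    apply/existsP; apply: contraNT sum_neq0 => /existsPn Ax0.
    by rewrite big1 // => i _; have /negPn/eqP := Ax0 i.
  rewrite mulf_eq0 negb_or => /andP[/A_le Aji /(coord_supp Mc)].
  exact: lev_const_le.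
pose f p x := projT1 (cid (ex p x)).
have fE p x j : crd' p j (f p x) = \sum_i A j i * crd p i x.
  by rewrite /f; case: cid.
have [g gE] : exists g : pmor M N, forall p x, g p x = f p x.
  apply: pmor_of => [p a x y|p q h x]; apply: (coord_inj Nc) => j.
    rewrite linearP !fE scaler_sumr -big_split /=; apply: eq_bigr => i _.
    by rewrite linearP /= mulrDr scalerAr [a *: _](mulrC a) mulrA [_ * a]mulrC mulrA.
  rewrite (coord_nat Nc) !fE; apply: eq_bigr => i _.
  by rewrite (coord_nat Mc).
by exists g => p x j; rewrite gE fE.
Qed.

Lemma coord_mor_id M N (I : finType) (c c' : I -> R) crd crd' :
    @is_coord M I c crd -> @is_coord N I c' crd' -> (forall i, c' i <= c i) ->
  exists f : pmor M N, forall p x i, crd' p i (f p x) = crd p i x.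
Proof.
move=> Mc Nc le_c.
have [|f fE] := coord_mor (A := fun j i => (j == i)%:R) Mc Nc.
  by move=> j i; case: (j =P i) => [->|]; rewrite ?eqxx.
exists f => p x i; rewrite fE (bigD1 i) //= eqxx mul1r big1 ?addr0 // => j.
by rewrite eq_sym => /negPf ->; rewrite mul0r.
Qed.

Lemma coord_iso M N (I : finType) (c : I -> R) crd crd' :
  @is_coord M I c crd -> @is_coord N I c crd' -> pm_iso M N.
Proof.
move=> Mc Nc.
have [f fE] := coord_mor_id Mc Nc (fun=> lexx _).
have [g gE] := coord_mor_id Nc Mc (fun=> lexx _).
exists f, g; split=> p x.
  by apply: (coord_inj Mc) => i; rewrite gE fE.
by apply: (coord_inj Nc) => i; rewrite fE gE.
Qed.

(** Conversely to [coord_mor], morphisms have no entries in other places: [x]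
is a combination of generators carried from the corners [c i], and by
naturality such a generator has image supported on corners [c' j <= c i]. *)
Lemma coord_hom_supp M N (I : finType) J (c : I -> R) (c' : J -> R) crd crd'
    (f : pmor M N) p (x : M p) j : (0 < d)%N ->
    @is_coord M I c crd -> @is_coord N J c' crd' -> crd' p j (f p x) != 0 ->
  exists2 i, crd p i x != 0 & c' j <= c i.
Proof.
move=> d_gt0 Mc Nc fxj_neq0; apply: contrapT => no_i.
have ex i : exists y : M p,
    (forall l, crd p l y = if l == i then crd p i x else 0) /\ crd' p j (f p y) = 0.
  have [xi0|xi_neq0] := eqVneq (crd p i x) 0.
    by exists 0; rewrite !linear0; split=> // l; rewrite xi0 linear0 if_same.
  have ip := coord_supp Mc xi_neq0.
  (* The multiple of the generator of the summand [i], at its own corner. *)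
  have [|g gE] := coord_surj Mc (p := const_mx (c i))
    (v := fun l => if l == i then crd p i x else 0).
    by move=> l; case: (l =P i) => [->|]; rewrite ?eqxx ?lev_refl.
  exists (pm_map M ip g); split=> [l|]; first by rewrite (coord_nat Mc).
  rewrite pmor_nat (coord_nat Nc); apply/eqP/negPn/negP => gj_neq0.
  by apply: no_i; exists i => //; apply: lev_const d_gt0 (coord_supp Nc gj_neq0).
pose y i := projT1 (cid (ex i)).
have yE i : (forall l, crd p l (y i) = if l == i then crd p i x else 0) /\
    crd' p j (f p (y i)) = 0 by rewrite /y; case: cid.
have xE : x = \sum_i y i.
  apply: (coord_inj Mc) => l; rewrite linear_sum (bigD1 l) //= big1 => [|i il].
    by rewrite (yE l).1 eqxx addr0.
  by rewrite (yE i).1 eq_sym (negPf il).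
case/eqP: fxj_neq0; rewrite xE !linear_sum big1 // => i _.
exact: (yE i).2.
Qed.

Lemma coord_shift M I (c : I -> R) crd e : @is_coord M I c crd ->
  @is_coord (shift M e) I (fun i => c i - e) (fun p => crd (translate p e)).
Proof.
move=> Mc; split=> [p q h x i|p x y|p x i|p v vP].
- exact: coord_nat Mc _ _ _ _ _.
- exact: coord_inj Mc _ _ _.
- by rewrite -lev_const_translate; apply: coord_supp Mc _ _ _.
- by apply: (coord_surj Mc) => i; rewrite lev_const_translate; apply: vP.
Qed.

(** Both interleaving morphisms are identity matrices. *)
Lemma coord_interleaved M N (I : finType) (c c' : I -> R) crd crd' e (e0 : 0 <= e) :
    @is_coord M I c crd -> @is_coord N I c' crd' ->
    (forall i, c' i - e <= c i) -> (forall i, c i - e <= c' i) ->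
  interleaved e0 M N.
Proof.
move=> Mc Nc le_c' le_c.
have [f fE] := coord_mor_id Mc (coord_shift e Nc) le_c'.
have [g gE] := coord_mor_id Nc (coord_shift e Mc) le_c.
exists f, g; split=> p x.
  apply: (coord_inj Mc) => i; rewrite (coord_nat Mc) -[RHS]fE; exact: gE.
apply: (coord_inj Nc) => i; rewrite (coord_nat Nc) -[RHS]gE; exact: fE.
Qed.

Definition upset_coef (b : bool) : {linear upset_space k b -> k^o} :=
  if b return {linear upset_space k b -> k^o} then idfun else \0.

Definition orthant_coef (c : R) p : {linear upset_pm k (orthant d c) p -> k^o} :=
  upset_coef `[< up_set (orthant d c) p >].

Lemma coord_orthant c :
  @is_coord (upset_pm k (orthant d c)) unit (fun=> c) (fun p _ => orthant_coef c p).
Proof.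
split=> [p q h x i|p x y /(_ tt)|p x i|p v /(_ tt)].
- rewrite /orthant_coef /=.
  have : `[< up_set (orthant d c) p >] ==> `[< up_set (orthant d c) q >].
    by apply/implyP => /asboolP Up; apply/asboolP/(up_closed Up).
  move: x => /=.
  by case: `[< up_set (orthant d c) p >]; case: `[< up_set (orthant d c) q >].
- rewrite /orthant_coef; move: x y => /=.
  by case: `[< up_set (orthant d c) p >] => //= x y _; rewrite [x]thinmx0 [y]thinmx0.
- rewrite /orthant_coef; move: x => /=; case: asboolP => //= _ x.
  by rewrite eqxx.
- move=> vP; have {vP} : v tt != 0 -> `[< up_set (orthant d c) p >].
    by move/vP=> ?; apply/asboolP.
  rewrite /orthant_coef /=; case: `[< _ >] => [_|v0].
    by exists (v tt); case.
  by exists 0; case; apply/esym/eqP/negPn/negP => /v0.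
Qed.

Lemma coord_dsum (I : finType) (F : I -> pmod) (c : I -> R)
    (crdF : forall i p, unit -> {linear F i p -> k^o}) :
    (forall i, is_coord (fun=> c i) (crdF i)) ->
  exists crd, @is_coord (dsum_pm F) I c crd.
Proof.
move=> Fc.
have lin p i : linear (fun x : dsum_pm F p => crdF i p tt (x i) : k^o).
  by move=> a x y; rewrite linearP.
exists (fun p i => linear_of (lin p i)).
split=> [p q h x i|p x y xy|p x i|p v vP].
- exact: coord_nat (Fc i) _ _ _ _ _.
- by apply: dsumP => i; apply: (coord_inj (Fc i)) => -[]; apply: xy.
- exact: coord_supp (Fc i) _ _ _.
have ex i : exists x : F i p, crdF i p tt x = v i.
  have [|x xE] := coord_surj (Fc i) (p := p) (v := fun=> v i).
    by move=> _; apply: vP.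
  by exists x.
pose x i := projT1 (cid (ex i)).
exists (@DsumSpace _ _ (fun i => F i p) x finite_finset) => i.
by rewrite /= /x; case: cid.
Qed.

Lemma coord_dsum_orthant (I : finType) (c : I -> R) :
  exists crd, @is_coord (dsum_pm (fun i => upset_pm k (orthant d (c i)))) I c crd.
Proof. exact: coord_dsum (fun i => coord_orthant (c i)). Qed.

Lemma orthant_interleaved (a b e : R) (e0 : 0 <= e) : a - e <= b -> b - e <= a ->
  interleaved e0 (upset_pm k (orthant d a)) (upset_pm k (orthant d b)).
Proof.
by move=> ab ba; apply: coord_interleaved (coord_orthant a) (coord_orthant b) _ _.
Qed.

(** If both summands were nonzero, elements of each could be carried to a
common point, where they would remain nonzero and linearly independent; but
the spaces of an orthant module have dimension at most one. *)
Lemma coord_indecomposable M c crd :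
  @is_coord M unit (fun=> c) crd -> indecomposable M.
Proof.
move=> Mc; split=> [M0|F MF].
  by have /(coord_zero_atP _ Mc)/(_ tt)/negP := M0 (const_mx c); apply; apply: lev_refl.
have [f [g [_ fg]]] := MF.
apply: contrapT => /not_orP[/existsNP[p /existsNP[x x_neq0]] /existsNP[q /existsNP[y y_neq0]]].
pose r : 'rV[R]_d := \row_i Num.max (p 0 i) (q 0 i).
have pr : lev p r by apply/levP => i; rewrite mxE le_max lexx.
have qr : lev q r by apply/levP => i; rewrite mxE le_max lexx orbT.
pose u : dsum_pm F p := DsumSpace (ds_single_fin (V := fun b => F b p) x).
pose v : dsum_pm F q := DsumSpace (ds_single_fin (V := fun b => F b q) y).
have nz : pm_mono (dsum_pm F) := pm_mono_iso (pm_iso_sym MF) (coord_mono Mc).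
have u_neq0 : pm_map (dsum_pm F) pr u <> 0.
  move=> /nz /(congr1 (fun w => ds_val w true)).
  by rewrite /= (ds_singleE (V := fun b => F b p)).
have v_neq0 : pm_map (dsum_pm F) qr v <> 0.
  move=> /nz /(congr1 (fun w => ds_val w false)).
  by rewrite /= (ds_singleE (V := fun b => F b q)).
set U := pm_map _ pr u in u_neq0; set V := pm_map _ qr v in v_neq0.
pose a := crd r tt (g r U); pose b := crd r tt (g r V).
(* At [r] the vectors [U] and [V] lie on a line, with ratio [a : b]. *)
have b_neq0 : b != 0.
  apply/eqP => b0; apply: v_neq0; rewrite -[V]fg.
  by rewrite [g r V](coord_eq0 Mc) ?linear0 //; case.
have bUaV : b *: U = a *: V.
  rewrite -[U]fg -[V]fg -!linearZ; congr (f r _); apply: (coord_inj Mc) => -[].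
  by rewrite !linearZ /= -/a -/b /GRing.scale /= mulrC.
apply: u_neq0; apply: dsumP => -[].
  have := congr1 (fun w => ds_val w true) bUaV.
  rewrite dsumZE [in RHS]dsumZE [V true](_ : _ = 0) ?scaler0.
    by move=> /eqP; rewrite scaler_eq0 (negPf b_neq0) => /eqP.
  by rewrite /= ds_singleN ?linear0.
by rewrite /= ds_singleN ?linear0.
Qed.

Lemma barcode_orthant M (I : finType) (c : I -> R) :
    pm_iso M (dsum_pm (fun i => upset_pm k (orthant d (c i)))) ->
  barcode M (fun i => upset_pm k (orthant d (c i))).
Proof.
by move=> MF; split=> // i; apply: coord_indecomposable (coord_orthant (c i)).
Qed.

End Coordinates.

(** * Pruning a sum of orthants *)

Section PruningOrthants.
Variables (k : fieldType) (R : realType) (d : nat) (d_gt0 : (0 < d)%N).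
Variables (I : finType) (c : I -> R) (e : R) (e0 : 0 <= e).

(** The condition for a matrix unit from the summand [i] to the summand [j] to
be a morphism into the [2 * e]-shift. *)
Definition coupled : rel I := [rel i j | c j <= c i + 2 * e].

Definition reach i : I := [arg max_(j > i | connect coupled i j) c j]%O.

Lemma reach_connect i : connect coupled i (reach i).
Proof. by rewrite /reach; case: Order.TotalTheory.arg_maxP; rewrite ?connect0. Qed.

Lemma reach_max i j : connect coupled i j -> c j <= c (reach i).
Proof.
by rewrite /reach; case: Order.TotalTheory.arg_maxP; rewrite ?connect0 // => l _; apply.
Qed.

Lemma reach_coupled i j : coupled i j -> c (reach j) <= c (reach i).
Proof.
move=> ij; apply: reach_max.
exact: connect_trans (connect1 ij) (reach_connect j).
Qed.

Variables (M : pmodule k R d) (crd : forall p, I -> {linear M p -> k^o}).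
Hypothesis Mc : is_coord c crd.

(** The vectors supported on the summands [i] for which every reachable corner
is below the point form a submodule that morphisms into the [2 * e]-shift
preserve, since a coupling cannot increase the largest reachable corner. *)
Lemma pruI_sup p (x : M p) :
    (forall i, crd p i x != 0 -> lev (const_mx (c (reach i))) p) ->
  x \in pruI M e0 p.
Proof.
move=> x_supp.
pose S q (y : M q) := forall i, crd q i y != 0 -> lev (const_mx (c (reach i))) q.
have [T TE] : exists T : submodule M, forall q y, y \in T q <-> S q y.
  apply: subm_of => [q i|q a y z Sy Sz i|q r h y Sy i]; first by rewrite linear0 eqxx.
    rewrite linearP /= => yz_neq0.
    have [y0|/Sy //] := eqVneq (crd q i y) 0.
    by apply: Sz; apply: contraNneq yz_neq0 => z0; rewrite y0 z0 addr0 [_ *: _]mulr0.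
  by rewrite (coord_nat Mc) => /Sy yq; apply: lev_trans yq h.
apply: (@pruI_largest _ _ _ _ _ _ T); last exact/TE.
move=> f q y /TE Sy.
have fy_supp j : crd (translate q (2 * e)) j (f q y) != 0 ->
    lev (const_mx (c (reach j))) q.
  move=> fyj; have [i yi_neq0] := coord_hom_supp (f := f) d_gt0 Mc (coord_shift _ Mc) fyj.
  rewrite lerBlDr => /reach_coupled ij.
  exact: lev_const_le ij (Sy i yi_neq0).
have [|z zE] := coord_surj Mc (p := q) (v := fun j => crd (translate q (2 * e)) j (f q y)).
  by move=> j /fy_supp; apply: lev_const_le; apply: reach_max; apply: connect0.
exists z; first by apply/TE => j; rewrite zE; apply: fy_supp.
by apply: (coord_inj Mc) => j; rewrite (coord_nat Mc) zE.
Qed.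

(** Matrix units along a chain of couplings turn a nonzero coordinate [i] into
a nonzero coordinate at the end of the chain without leaving the space of the
submodule at [p], so the corner at the end of the chain is below [p]. *)
Lemma pruI_sub p (x : M p) : x \in pruI M e0 p ->
  forall i, crd p i x != 0 -> lev (const_mx (c (reach i))) p.
Proof.
move=> xI i xi_neq0.
have step (j l : I) y : coupled j l -> y \in pruI M e0 p -> crd p j y != 0 ->
    exists2 z, z \in pruI M e0 p & crd p l z != 0.
  move=> jl yI yj_neq0.
  have [|f fE] := coord_mor (A := fun a b => ((a == l) && (b == j))%:R)
      Mc (coord_shift (2 * e) Mc).
    move=> a b; case: (a =P l) => [->|]; case: (b =P j) => [->|]; rewrite ?eqxx // => _.
    by rewrite lerBlDr.
  have [z zI fz] := pruI_condP f yI; exists z => //.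
  have := fE p y l; rewrite fz (coord_nat Mc) => ->.
  rewrite (bigD1 j) //= !eqxx mul1r big1 ?addr0 // => b /negPf ->.
  by rewrite andbF mul0r.
have [s path_s ->] := connectP (reach_connect i).
elim: s i x xI xi_neq0 path_s => [|j s IHs] i x xI xi_neq0 /=.
  by move=> _; apply: coord_supp Mc _ _ _ xi_neq0.
case/andP => ij; have [z zI zj_neq0] := step _ _ _ ij xI xi_neq0.
exact: IHs zI zj_neq0.
Qed.

Lemma pruI_coord : exists crdI,
  @is_coord k R d (sub_pm (pruI M e0)) I (fun i => c (reach i)) crdI.
Proof.
have lin p i : linear (fun x : sub_pm (pruI M e0) p => crd p i (val x) : k^o).
  by move=> a x y; rewrite !linearP.
exists (fun p i => linear_of (lin p i)).
split=> [p q h x i|p x y xy|p x i|p v vP].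
- exact: coord_nat Mc _ _ _ _ _.
- by apply: val_inj; apply: (coord_inj Mc) => i; apply: xy.
- exact: pruI_sub (valP x) i.
have [|x xE] := coord_surj Mc (p := p) (v := v).
  by move=> i /vP; apply: lev_const_le; apply: reach_max; apply: connect0.
have xI : x \in pruI M e0 p.
  by apply: pruI_sup => i; rewrite xE; apply: vP.
by exists (SubSpace xI).
Qed.

(** The zero submodule satisfies the condition that defines [pruK]: its image
under any morphism is zero, and so is the preimage of zero under an injective
structure map. *)
Lemma pruK_eq0 p x : x \in pruK M e0 p -> x = 0.
Proof.
have [crdI Ic] := pruI_coord.
have [T TE] : exists T : submodule (sub_pm (pruI M e0)), forall q y, y \in T q <-> y = 0.
  by apply: subm_of => [q|q a y z -> ->|q r h y ->]; rewrite ?linear0 ?addr0.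
move=> xK; apply/TE; apply: pruK_smallest xK => f q y z /TE -> yz.
apply/TE; apply: (coord_mono Ic (h := lev_translater q (mul2_ge0 e0))).
apply: val_inj; exact: etrans yz (linear0 _).
Qed.

Lemma pruning_orthants :
  pm_iso (pruning M e0)
    (dsum_pm (fun i => upset_pm k (orthant d (c (reach i) + e)))).
Proof.
apply: (pm_iso_trans (M := shift (sub_pm (pruI M e0)) (- e))).
  by apply/pm_iso_shift/pm_iso_sym/pm_iso_quot0/pruK_eq0.
have [crdI Ic] := pruI_coord.
have [crd' Dc] := coord_dsum_orthant k d (fun i => c (reach i) + e).
have := coord_shift (- e) Ic.
have -> : (fun i => c (reach i) - - e) = (fun i => c (reach i) + e).
  by apply: funext => i; rewrite opprK.
by move=> Sc; apply: coord_iso Sc Dc.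
Qed.

End PruningOrthants.

(** * Distances between sums of orthants *)

Section Distances.
Variables (k : fieldType) (R : realType) (d : nat).
Local Notation orthants c := (dsum_pm (fun i => upset_pm k (orthant d (c i)))).

Lemma refinement_orthants (Q M : pmodule k R d) (I : finType) (s t : I -> R) :
    pm_iso Q (orthants s) -> pm_iso M (orthants t) -> (forall i, t i <= s i) ->
  refinement Q M.
Proof.
move=> Qs Mt ts.
exists I, (fun i => upset_pm k (orthant d (t i))), (fun i => upset_pm k (orthant d (s i))).
split; first exact: barcode_orthant Mt; split=> // i.
have [f fE] := coord_mor_id (coord_orthant k d (s i)) (coord_orthant k d (t i))
  (fun=> ts i).
apply: (subquotient_inj (f := f)) => p x fx0.
apply: (coord_eq0 (coord_orthant k d (s i))) => j.
by apply: etrans (esym (fE p x j)) _; rewrite fx0 linear0.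
Qed.

Lemma matching_orthants (I : finType) (a b : I -> R) e (e0 : 0 <= e) :
    (forall i, a i - e <= b i) -> (forall i, b i - e <= a i) ->
  matching e0 (orthants a) (orthants b).
Proof.
move=> ab ba; exists I, I, (fun i => upset_pm k (orthant d (a i))),
  (fun i => upset_pm k (orthant d (b i))).
split; first exact/barcode_orthant/pm_iso_refl.
split; first exact/barcode_orthant/pm_iso_refl.
exists [set: I]%classic, [set: I]%classic, id; split; first by exists id.
by split=> [i|]; [apply: orthant_interleaved | split=> i; case].
Qed.

Lemma ereal_inf_min (S : set R) x : S x -> (forall y, S y -> x <= y) ->
  ereal_inf [set y%:E | y in S] = x%:E.
Proof.
move=> Sx x_min; apply/eqP; rewrite eq_le; apply/andP; split.
  by apply: ereal_inf_lbound; exists x.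
by apply: le_ereal_inf_tmp => _ [y Sy <-]; rewrite lee_fin; apply: x_min.
Qed.

End Distances.

(** * The staircase of corners *)

Definition stair (R : realType) (alpha : R) (r : nat) (i : 'I_r) : R :=
  2 * i.+1%:R * alpha.

Lemma stair_le (R : realType) (alpha : R) r (i : 'I_r) : 0 < alpha ->
  stair alpha i <= 2 * r%:R * alpha.
Proof. by move=> alpha_gt0; rewrite ler_pM2r // ler_pM2l // ler_nat. Qed.

Lemma le_stair (R : realType) (alpha : R) r (i : 'I_r) : 0 < alpha ->
  2 * alpha <= stair alpha i.
Proof. by move=> alpha_gt0; rewrite ler_pM2r // ler_peMr // ler1n. Qed.

(** Below [alpha] the gap [2 * alpha] to the next corner is too large, so the
lowest corner is coupled to nothing else. *)
Lemma stair_reach_small (R : realType) (alpha e : R) r (i : 'I_r) :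
    0 < alpha -> e < alpha -> nat_of_ord i = 0 ->
  reach (@stair R alpha r) e i = i.
Proof.
move=> alpha_gt0 ea i0; set c := @stair R alpha r.
have /connectP[s path_s ->] := reach_connect c e i.
elim: s path_s => //= l s IHs /andP[il path_s].
suff li : l = i by rewrite li in path_s *; apply: IHs.
apply: val_inj; rewrite /= i0; case: l il {path_s} => -[//|n] nr.
rewrite /coupled /= /c /stair i0 /= => le_n; exfalso.
have : 2 * alpha <= n.+2%:R * alpha by rewrite ler_pM2r // ler_nat.
lra.
Qed.

(** From [alpha] on, every index is coupled to the lowest one and each step to
the next one, so the highest corner is reachable from everywhere. *)
Lemma stair_reach_big (R : realType) (alpha e : R) r (i : 'I_r) :
    0 < alpha -> alpha <= e ->
  stair alpha (reach (@stair R alpha r) e i) = 2 * r%:R * alpha.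
Proof.
move=> alpha_gt0 ae; apply/eqP; rewrite eq_le stair_le //=.
have conn n (nr : (n < r)%N) : connect (coupled (@stair R alpha r) e) i (Ordinal nr).
  elim: n nr => [|n IHn] nr.
    apply: connect1; rewrite /coupled /= [stair _ (Ordinal nr)]/stair /=.
    by have := le_stair i alpha_gt0; lra.
  apply: connect_trans (IHn (ltnW nr)) _; apply: connect1.
  by rewrite /coupled /= /stair /= -[n.+2%:R]natr1; lra.
case: r i conn => [[]//|m] i conn.
exact: (reach_max (conn m (ltnSn m))).
Qed.

(** * The three distances *)

Theorem mainTheorem4 (k : fieldType) (R : realType) (alpha : R) (d r : nat)
    (alpha_gt0 : 0 < alpha) (d_ge1 : (1 <= d)%N) (r_ge1 : (1 <= r)%N) :
  let M := dsum_pm (fun i : 'I_r =>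
    upset_pm k (orthant d (2 * i.+1%:R * alpha))) in
  let N := dsum_pm (fun i : 'I_r =>
    upset_pm k (orthant d ((2 * r%:R + 1) * alpha))) in
  dP M N = alpha%:E /\
  dB M N = ((2 * r%:R - 1) * alpha)%:E /\
  dI M N = ((2 * r%:R - 1) * alpha)%:E.
Proof.
move=> M N.
pose a := @stair R alpha r; pose b := (2 * r%:R + 1) * alpha.
have [crdM Mc] := coord_dsum_orthant k d a; rewrite -/M in crdM Mc.
have [crdN Nc] := coord_dsum_orthant k d (fun _ : 'I_r => b); rewrite -/N in crdN Nc.
pose i0 : 'I_r := Ordinal r_ge1.
have a0 : a i0 = 2 * alpha by rewrite /a /stair /= mulr1.
have r1 : alpha <= r%:R * alpha by rewrite ler_peMl ?ler1n // ltW.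
have D_ge0 : 0 <= (2 * r%:R - 1) * alpha by lra.
have ab i : a i - (2 * r%:R - 1) * alpha <= b.
  by have := stair_le i alpha_gt0; rewrite -/a /b; lra.
have ba i : b - (2 * r%:R - 1) * alpha <= a i.
  by have := le_stair i alpha_gt0; rewrite -/a /b; lra.
(* [N] vanishes at [2 * alpha + e] whenever [e < (2 * r - 1) * alpha]. *)
have lower e : (zero_at N (translate (const_mx (a i0)) e) -> zero_at M (const_mx (a i0))) ->
    (2 * r%:R - 1) * alpha <= e.
  move=> NM; rewrite leNgt; apply/negP => eD.
  have /(coord_zero_atP _ Mc)/(_ i0)/negP : zero_at M (const_mx (a i0)).
    apply: NM; apply/(coord_zero_atP _ Nc) => i.
    rewrite lev_const_translate; apply/negP => /(lev_const d_ge1).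
    by rewrite a0 /b; lra.
  by apply; apply: lev_refl.
split; last split; first last.
- apply: ereal_inf_min => [|e [e0 MN]]; first by exists D_ge0; apply: coord_interleaved Mc Nc _ _.
  exact: lower (zero_at_interleaved (coord_mono Mc) MN).
- apply: ereal_inf_min => [|e [e0 MN]]; first by exists D_ge0; apply: matching_orthants.
  exact: lower (zero_at_matching (coord_mono Mc) MN).
have pruM t (t0 : 0 <= t) := pruning_orthants d_ge1 t0 Mc.
have pruN t (t0 : 0 <= t) := pruning_orthants d_ge1 t0 Nc.
apply: ereal_inf_min => [|e [e0 /(_ 0 (lexx 0))[MN _]]].
  exists (ltW alpha_gt0) => t t0; split; apply: refinement_orthants.
  - exact: pruM.
  - exact: pruN.
  - by move=> i; rewrite /a stair_reach_big ?lerDl // /b; lra.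
  - exact: pruN.
  - exact: pruM.
  - by move=> i; have := stair_le (reach a t i) alpha_gt0; rewrite -/a /b; lra.
(* If [e < alpha], the pruning of [M] is nonzero at the corner coming from its
   lowest summand, whereas the 0-pruning of [N] vanishes there. *)
rewrite leNgt; apply/negP => ea.
pose p : 'rV[R]_d := const_mx (2 * alpha + e).
have : zero_at (pruning M (addr_ge0 e0 (lexx 0))) p.
  apply: (zero_at_refinement MN).
  apply: zero_at_iso (pruN _ _) _; apply/dsum_eq0P => i.
  apply/(coord_zero_atP _ (coord_orthant k d _)) => _.
  by apply/negP => /(lev_const d_ge1); rewrite /b; lra.
move/(zero_at_iso (pm_iso_sym (pruM _ _)))/dsum_eq0P/(_ i0).
move/(coord_zero_atP _ (coord_orthant k d _))/(_ tt)/negP; apply.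
rewrite addr0 /a stair_reach_small // -/a a0; exact: lev_refl.
Qed.
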